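(* Suppose $C\in\mathcal{C}^3_{\rm c}$ is not simplified. Then there exists a simplified copula $D\in\mathcal{C}^3_{\rm S}$ with $d_\infty(C,D)<d_\infty(C,\psi(C))$.
   Context: $\mathbb{I}=[0,1]$, $\lambda$ Lebesgue measure; $d_\infty(C_1,C_2)=\max_{\mathbf{x}\in\mathbb{I}^3}|C_1(\mathbf{x})-C_2(\mathbf{x})|$. Points of $\mathbb{I}^3$ are written $(\mathbf{u},v)$, $\mathbf{u}=(u_1,u_2)$. For a three-dimensional copula $C$, $K_C$ is (a version of) the regular conditional distribution of $(U_1,U_2)$ given $U_3=v$, $(U_1,U_2,U_3)\sim C$; $F_{1|3}(u_1|t)=K_C(t,[0,u_1]\times\mathbb{I})$, $F_{2|3}(u_2|t)=K_C(t,\mathbb{I}\times[0,u_2])$. By Sklar's theorem, for $\lambda$-a.e. $t$ there is a bivariate copula $C^t_{12;3}$ with $K_C(t,[\mathbf{0},\mathbf{u}])=C^t_{12;3}(F_{1|3}(u_1|t),F_{2|3}(u_2|t))$ for all $\mathbf{u}$. $\mathcal{C}^3_{\rm c}$ is the set of three-dimensional copulas for which $F_{1|3}(\cdot|t)$ and $F_{2|3}(\cdot|t)$ are continuous for $\lambda$-a.e. $t$ (then $C^t_{12;3}$ is unique for a.e. $t$). $C$ is simplified if $C\in\mathcal{C}^3_{\rm c}$ and there is a bivariate copula $A$ with $C(\mathbf{u},v)=\int_{[0,v]}A(F_{1|3}(u_1|t),F_{2|3}(u_2|t))\,d\lambda(t)$ for all $(\mathbf{u},v)$; $\mathcal{C}^3_{\rm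 S}$ is the set of simplified copulas. For $C\in\mathcal{C}^3_{\rm c}$, the partial copula is $C_p(\mathbf{s})=\int_{\mathbb{I}}C^t_{12;3}(\mathbf{s})\,d\lambda(t)$ and the partial vine copula is $\psi(C)(\mathbf{u},v)=\int_{[0,v]}C_p(F_{1|3}(u_1|t),F_{2|3}(u_2|t))\,d\lambda(t)$. *)

(* Defs.v *)
From HB Require Import structures.
From mathcomp Require Import all_boot all_order all_algebra.
From mathcomp Require Import all_classical all_reals all_analysis.
Set Implicit Arguments. Unset Strict Implicit. Unset Printing Implicit Defensive.
Import Order.TTheory GRing.Theory Num.Theory.
Import numFieldNormedType.Exports.
Local Open Scope classical_set_scope.
Local Open Scope ring_scope.

Definition II {R : realType} : set R := `[0%R, 1%R].

Definition copula2 {R : realType} (A : R -> R -> R) : Prop :=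
  (forall u, II u -> [/\ A 0 u = 0, A u 0 = 0, A 1 u = u & A u 1 = u]) /\
  (forall a1 b1 a2 b2, II a1 -> II b1 -> II a2 -> II b2 ->
     a1 <= b1 -> a2 <= b2 -> 0 <= A b1 b2 - A a1 b2 - A b1 a2 + A a1 a2).

Definition copula3 {R : realType} (C : R -> R -> R -> R) : Prop :=
  (forall x y, II x -> II y ->
     [/\ C 0 x y = 0, C x 0 y = 0 & C x y 0 = 0]) /\
  (forall u, II u -> [/\ C u 1 1 = u, C 1 u 1 = u & C 1 1 u = u]) /\
  (forall a1 b1 a2 b2 a3 b3, II a1 -> II b1 -> II a2 -> II b2 -> II a3 -> II b3 ->
     a1 <= b1 -> a2 <= b2 -> a3 <= b3 ->
     0 <= C b1 b2 b3 - C a1 b2 b3 - C b1 a2 b3 - C b1 b2 a3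
          + C a1 a2 b3 + C a1 b2 a3 + C b1 a2 a3 - C a1 a2 a3).

(* K is a version of the regular conditional distribution of (U1,U2)
   given U3 = t, for (U1,U2,U3) ~ C (U3 is uniform on I). *)
Definition cond_dist_version {R : realType} (C : R -> R -> R -> R)
  (K : R.-pker R ~> (R * R)%type) : Prop :=
  forall u1 u2 v, II u1 -> II u2 -> II v ->
    (C u1 u2 v)%:E =
      (\int[@lebesgue_measure R]_(t in `[0%R, v]) K t (`[0%R, u1] `*` `[0%R, u2]))%E.

Definition F13 {R : realType} (K : R.-pker R ~> (R * R)%type) (u1 t : R) : R :=
  fine (K t (`[0%R, u1] `*` II)).
Definition F23 {R : realType} (K : R.-pker R ~> (R * R)%type) (u2 t : R) : R :=
  fine (K t (II `*` `[0%R, u2])).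

Definition cont_margins {R : realType} (K : R.-pker R ~> (R * R)%type) : Prop :=
  {ae @lebesgue_measure R, forall t, II t ->
     continuous (fun u => F13 K u t) /\ continuous (fun u => F23 K u t)}.

Definition in_C3c {R : realType} (C : R -> R -> R -> R)
  (K : R.-pker R ~> (R * R)%type) : Prop :=
  copula3 C /\ cond_dist_version C K /\ cont_margins K.

Definition simplified {R : realType} (C : R -> R -> R -> R) : Prop :=
  exists K : R.-pker R ~> (R * R)%type, in_C3c C K /\
  exists A : R -> R -> R, copula2 A /\
    forall u1 u2 v, II u1 -> II u2 -> II v ->
      (C u1 u2 v)%:E =
        (\int[@lebesgue_measure R]_(t in `[0%R, v]) (A (F13 K u1 t) (F23 K u2 t))%:E)%E.

(* Ct t is the (a.e. unique) conditional copula C^t_{12;3} from Sklar's theorem. *)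
Definition sklar_family {R : realType} (K : R.-pker R ~> (R * R)%type)
  (Ct : R -> R -> R -> R) : Prop :=
  (forall s1 s2, measurable_fun setT (fun t => Ct t s1 s2)) /\
  {ae @lebesgue_measure R, forall t, II t ->
     copula2 (Ct t) /\
     forall u1 u2, II u1 -> II u2 ->
       K t (`[0%R, u1] `*` `[0%R, u2]) = (Ct t (F13 K u1 t) (F23 K u2 t))%:E}.

Definition partial_copula {R : realType} (Ct : R -> R -> R -> R) (s1 s2 : R) : R :=
  fine (\int[@lebesgue_measure R]_(t in II) (Ct t s1 s2)%:E)%E.

Definition pvc {R : realType} (K : R.-pker R ~> (R * R)%type)
  (Ct : R -> R -> R -> R) (u1 u2 v : R) : R :=
  fine (\int[@lebesgue_measure R]_(t in `[0%R, v])
          (partial_copula Ct (F13 K u1 t) (F23 K u2 t))%:E)%E.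

(* Sup-distance on I^3 (a max for the continuous functions considered). *)
Definition dinf {R : realType} (C1 C2 : R -> R -> R -> R) : R :=
  sup [set r : R | exists u1 u2 v, [/\ II u1, II u2, II v &
         r = `|C1 u1 u2 v - C2 u1 u2 v|]].

(* Main.v *)
(* The simplified copulas are dense: C is within 3/n of its checkerboard
   approximation D, which spreads the C-mass of each cell of the n^3 grid. To
   realise D with conditional copulas equal to the independence copula, the unit
   interval of the third variable is cut into consecutive pieces, one per cell and
   as long as the mass of that cell, ordered so that the pieces of each
   horizontal slab fill that slab; over a piece, the first two variables are
   independent and uniform on the sides of the cell. Then D and C agree at the
   grid points. Since psi(C) is a simplified copula as soon as it equals C,
   d(C, psi(C)) > 0 and a fine enough grid concludes. *)

Require Import Defs.
From HB Require Import structures.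
From mathcomp Require Import all_boot all_order all_algebra.
From mathcomp Require Import ring lra.
From mathcomp Require Import all_classical all_reals all_analysis measurable_realfun.
Set Implicit Arguments.
Unset Strict Implicit.
Unset Printing Implicit Defensive.
Import Order.TTheory GRing.Theory Num.Theory numFieldNormedType.Exports.
Local Open Scope ring_scope.

Lemma II_itv {R : realType} (u : R) : II u <-> 0 <= u <= 1.
Proof. by rewrite /II /= in_itv. Qed.

Lemma II0 {R : realType} : II (0 : R).
Proof. by apply/II_itv; rewrite lexx ler01. Qed.

Lemma II1 {R : realType} : II (1 : R).
Proof. by apply/II_itv; rewrite ler01 lexx. Qed.

#[local] Hint Resolve II0 II1 : core.

(** * Trivariate copulas: monotonicity and Lipschitz bounds *)

Section Copula3.
Context {R : realType}.
Implicit Types (f : R -> R) (F C : R -> R -> R -> R).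

Definition incr3 F := forall a1 b1 a2 b2 a3 b3,
  II a1 -> II b1 -> II a2 -> II b2 -> II a3 -> II b3 ->
  a1 <= b1 -> a2 <= b2 -> a3 <= b3 ->
  0 <= F b1 b2 b3 - F a1 b2 b3 - F b1 a2 b3 - F b1 b2 a3
       + F a1 a2 b3 + F a1 b2 a3 + F b1 a2 a3 - F a1 a2 a3.

Lemma incr3_sum m (G : nat -> R -> R -> R -> R) :
  (forall i, (i < m)%N -> incr3 (G i)) ->
  incr3 (fun x y z => \sum_(0 <= i < m) G i x y z).
Proof.
elim: m => [|m ih] Gi a1 b1 a2 b2 a3 b3 ha1 hb1 ha2 hb2 ha3 hb3 h1 h2 h3.
  by rewrite !big_geq//; lra.
rewrite !big_nat_recr//=.
have := ih (fun i im => Gi i (ltnW im)) a1 b1 a2 b2 a3 b3.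
have := Gi m (leqnn _) a1 b1 a2 b2 a3 b3.
move=> /(_ ha1 hb1 ha2 hb2 ha3 hb3 h1 h2 h3) A.
move=> /(_ ha1 hb1 ha2 hb2 ha3 hb3 h1 h2 h3) B.
lra.
Qed.

(** The box increment of a product factors into three one-dimensional increments. *)
Lemma incr3_prod f g h : {homo f : x y / x <= y} -> {homo g : x y / x <= y} ->
  {homo h : x y / x <= y} -> incr3 (fun x y z => f x * g y * h z).
Proof.
move=> mf mg mh a1 b1 a2 b2 a3 b3 _ _ _ _ _ _ h1 h2 h3.
set e := (X in 0 <= X).
have -> : e = (f b1 - f a1) * (g b2 - g a2) * (h b3 - h a3) by rewrite /e; ring.
by rewrite !mulr_ge0// subr_ge0; [exact: mf|exact: mg|exact: mh].
Qed.

(** The difference is the volume of the box [[x,x'] x [0,y] x [0,z]]. Adding the boxes [[x,x'] x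
    [y,1] x [0,z]] and [[x,x'] x [0,1] x [z,1]] completes it to the full slab over [[x,x']], whose
    mass is [x' - x]. *)
Lemma copula3_mono1 C x x' y z : copula3 C -> II x -> II x' -> II y -> II z ->
  x <= x' -> 0 <= C x' y z - C x y z <= x' - x.
Proof.
move=> [C0 [C1 Ci]] hx hx' hy hz xx'.
have [y0 y1] := andP (proj1 (II_itv _) hy); have [z0 z1] := andP (proj1 (II_itv _) hz).
have [? ? ?] := C0 y z hy hz.
have [_ A _] := C0 x z hx hz; have [_ A' _] := C0 x' z hx' hz.
have [_ _ B] := C0 x y hx hy; have [_ _ B'] := C0 x' y hx' hy.
have [_ D E] := C0 x 1 hx II1; have [_ D' E'] := C0 x' 1 hx' II1.
have [_ G _] := C0 x 0 hx II0; have [_ G' _] := C0 x' 0 hx' II0.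
have [I _ _] := C1 x hx; have [I' _ _] := C1 x' hx'.
have J := Ci x x' 0 y 0 z hx hx' II0 hy II0 hz xx' y0 z0.
have J1 := Ci x x' y 1 0 z hx hx' hy II1 II0 hz xx' y1 z0.
have J2 := Ci x x' 0 1 z 1 hx hx' II0 II1 hz II1 xx' ler01 z1.
lra.
Qed.

Lemma copula3_swap12 C : copula3 C -> copula3 (fun x y z => C y x z).
Proof.
move=> [C0 [C1 Ci]]; split; [|split].
- move=> x y hx hy; have [? _ _] := C0 x y hx hy; have [_ ? _] := C0 x y hx hy.
  by have [_ _ ?] := C0 y x hy hx.
- by move=> u hu; have [? ? ?] := C1 u hu.
move=> a1 b1 a2 b2 a3 b3 ha1 hb1 ha2 hb2 ha3 hb3 h1 h2 h3.
by have := Ci a2 b2 a1 b1 a3 b3 ha2 hb2 ha1 hb1 ha3 hb3 h2 h1 h3; lra.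
Qed.

Lemma copula3_swap13 C : copula3 C -> copula3 (fun x y z => C z y x).
Proof.
move=> [C0 [C1 Ci]]; split; [|split].
- move=> x y hx hy; have [? _ _] := C0 y x hy hx; have [_ ? _] := C0 y x hy hx.
  by have [_ _ ?] := C0 y x hy hx; split => //; have [? ? ?] := C0 x y hx hy.
- by move=> u hu; have [? ? ?] := C1 u hu.
move=> a1 b1 a2 b2 a3 b3 ha1 hb1 ha2 hb2 ha3 hb3 h1 h2 h3.
by have := Ci a3 b3 a2 b2 a1 b1 ha3 hb3 ha2 hb2 ha1 hb1 h3 h2 h1; lra.
Qed.

Lemma copula3_mono2 C x y y' z : copula3 C -> II x -> II y -> II y' -> II z ->
  y <= y' -> 0 <= C x y' z - C x y z <= y' - y.
Proof. by move=> /copula3_swap12 cC hx hy hy' hz; exact: (copula3_mono1 cC). Qed.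

Lemma copula3_mono3 C x y z z' : copula3 C -> II x -> II y -> II z -> II z' ->
  z <= z' -> 0 <= C x y z' - C x y z <= z' - z.
Proof. by move=> /copula3_swap13 cC hx hy hz hz'; exact: (copula3_mono1 cC). Qed.

Lemma copula3_lip C x x' y y' z z' : copula3 C ->
  II x -> II x' -> II y -> II y' -> II z -> II z' ->
  x <= x' -> y <= y' -> z <= z' ->
  0 <= C x' y' z' - C x y z <= (x' - x) + (y' - y) + (z' - z).
Proof.
move=> cC hx hx' hy hy' hz hz' xx yy zz.
have := copula3_mono1 cC hx hx' hy hz xx.
have := copula3_mono2 cC hx' hy hy' hz yy.
have := copula3_mono3 cC hx' hy' hz hz' zz.
lra.
Qed.

Lemma copula3_itv C x y z : copula3 C -> II x -> II y -> II z ->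
  0 <= C x y z <= 1.
Proof.
move=> cC hx hy hz; have [C0 [C1 _]] := cC.
have [A _ _] := C0 y z hy hz; have [_ _ B] := C1 1 II1.
move: (proj1 (II_itv _) hx) (proj1 (II_itv _) hy) (proj1 (II_itv _) hz).
move=> /andP[x0 x1] /andP[y0 y1] /andP[z0 z1].
have := copula3_mono1 cC II0 hx hy hz x0.
have := copula3_lip cC hx II1 hy II1 hz II1 x1 y1 z1.
lra.
Qed.

End Copula3.

(** * Ramp functions and telescoping sums *)

Section Ramp.
Context {R : realType}.

(** For [a <= b] this is the length of the part of [[a,b]] below [x]. Written as a difference, it
    telescopes over consecutive intervals. *)
Definition ramp (a b x : R) : R := Num.min x b - Num.min x a.

Lemma ramp_homo a b : a <= b -> {homo ramp a b : x y / x <= y}.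
Proof. by rewrite /ramp => ab x y xy; rewrite /Num.min; do ! case: ifP; lra. Qed.

Lemma ramp_low a b x : a <= b -> x <= a -> ramp a b x = 0.
Proof. by move=> ab xa; rewrite /ramp !min_l ?subrr// (le_trans xa). Qed.

Lemma ramp_high a b x : a <= b -> b <= x -> ramp a b x = b - a.
Proof. by move=> ab bx; rewrite /ramp !min_r// (le_trans ab). Qed.

Lemma sum_ramp (f : nat -> R) m x :
  \sum_(0 <= j < m) ramp (f j) (f j.+1) x = ramp (f 0%N) (f m) x.
Proof. by rewrite /ramp (telescope_sumr (fun j => Num.min x (f j))). Qed.

Lemma sum_telescope_lt (f : nat -> R) (I m : nat) : (I <= m)%N ->
  \sum_(0 <= i < m) (i < I)%:R * (f i.+1 - f i) = f I - f 0%N.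
Proof.
(* With [minn m I] in place of [I], the claim holds for every [m] and induction on [m] goes
   through. *)
move=> Im; suff -> : \sum_(0 <= i < m) (i < I)%:R * (f i.+1 - f i) =
  f (minn m I) - f 0%N by rewrite (minn_idPr Im).
elim: m {Im} => [|m ih]; first by rewrite big_geq// min0n subrr.
rewrite big_nat_recr//= ih; case: ltnP => mI.
  by rewrite (minn_idPl mI) mul1r; ring.
by rewrite (minn_idPr (leqW mI)) mul0r addr0.
Qed.

End Ramp.


(** * The checkerboard approximation of a copula *)

Section Checkerboard.
Context {R : realType}.

Definition grid (n i : nat) : R := i%:R / n.+1%:R.

Lemma grid0 n : grid n 0 = 0. Proof. by rewrite /grid mul0r. Qed.

Lemma gridn n : grid n n.+1 = 1.
Proof. by rewrite /grid divff// pnatr_eq0. Qed.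

Lemma grid_le n i j : (i <= j)%N -> grid n i <= grid n j.
Proof. by move=> ij; rewrite /grid ler_pM2r ?ler_nat// invr_gt0 ltr0n. Qed.

Lemma gridS n i : grid n i.+1 - grid n i = n.+1%:R^-1.
Proof. by rewrite /grid -mulrBl -natrB// subSnn mul1r. Qed.

Lemma grid_lt n i : grid n i < grid n i.+1.
Proof. by rewrite -subr_gt0 gridS invr_gt0 ltr0n. Qed.

Lemma grid_II n i : (i <= n.+1)%N -> II (grid n i).
Proof.
by move=> h; apply/II_itv; rewrite -{1}(grid0 n) -(gridn n) !grid_le.
Qed.

Lemma grid_near n (u : R) : II u ->
  exists2 i, (i <= n.+1)%N & grid n i <= u <= grid n i + n.+1%:R^-1.
Proof.
move=> /II_itv/andP[u0 u1].
have n0 : 0 < n.+1%:R :> R by rewrite ltr0n.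
have nu0 : 0 <= u * n.+1%:R by rewrite mulr_ge0// ltW.
exists (Num.truncn (u * n.+1%:R)).
  rewrite -(ler_nat R) (le_trans (y := u * n.+1%:R)) ?Num.Theory.truncn_le//.
  by rewrite ler_piMl// ltW.
have /andP[A B] := Num.Theory.truncn_itv nu0.
rewrite /grid ler_pdivrMr// A/= -{2}[_^-1]mul1r -mulrDl natr1.
by rewrite ler_pdivlMr// ltW.
Qed.

(** This is the distribution function of the uniform law on the [i]-th grid interval. *)
Definition cell_cdf n i (u : R) : R :=
  n.+1%:R * ramp (grid n i) (grid n i.+1) u.

Lemma cell_cdf_homo n i : {homo cell_cdf n i : x y / x <= y}.
Proof.
by move=> x y xy; rewrite /cell_cdf ler_pM2l ?ltr0n// ramp_homo// grid_le.
Qed.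

Lemma cell_cdf_low n i u : u <= grid n i -> cell_cdf n i u = 0.
Proof. by move=> h; rewrite /cell_cdf ramp_low ?mulr0// grid_le. Qed.

Lemma cell_cdf_high n i u : grid n i.+1 <= u -> cell_cdf n i u = 1.
Proof.
by move=> h; rewrite /cell_cdf ramp_high ?grid_le// gridS divff// pnatr_eq0.
Qed.

Lemma cell_cdf0 n i : cell_cdf n i 0 = 0.
Proof. by rewrite cell_cdf_low// -(grid0 n) grid_le. Qed.

Lemma cell_cdf_ge0 n i u : 0 <= u -> 0 <= cell_cdf n i u.
Proof. by move=> u0; rewrite -(cell_cdf0 n i); exact: cell_cdf_homo. Qed.

Lemma cell_cdf1 n i : (i < n.+1)%N -> cell_cdf n i 1 = 1.
Proof. by move=> h; rewrite cell_cdf_high// -(gridn n) grid_le. Qed.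

Lemma cell_cdf_grid n i I : cell_cdf n i (grid n I) = (i < I)%:R.
Proof.
by case: ltnP => h; [rewrite cell_cdf_high// grid_le|rewrite cell_cdf_low// grid_le].
Qed.

Lemma sum_cell_cdf n u : II u ->
  \sum_(0 <= i < n.+1) cell_cdf n i u * n.+1%:R^-1 = u.
Proof.
move=> /II_itv/andP[u0 u1].
under eq_bigr do rewrite /cell_cdf mulrC mulKf ?pnatr_eq0//.
by rewrite sum_ramp grid0 gridn /ramp min_l// min_r// subr0.
Qed.

Variables (C : R -> R -> R -> R) (n : nat).
Hypothesis cC : copula3 C.
Local Notation g := (grid n).

(** The C-mass of [[0,x] x [0,y]] times the [k]-th grid interval; [slab] then restricts the first
    variable to the [i]-th interval and takes [y = g j]. *)
Definition strip k x y := C x y (g k.+1) - C x y (g k).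

Definition slab k i j := strip k (g i.+1) (g j) - strip k (g i) (g j).

(* The cells of the [n.+1]^3 grid, taken in lexicographic order of (k, i, j),
   split [0, 1] into consecutive intervals [brk k i j, brk k i j.+1[ whose
   lengths are the C-masses of the cells. *)
Definition brk k i j := g k + strip k (g i) 1 + slab k i j.

(** Over the piece of a cell, the first two variables have the product of two uniform distribution
    functions, constant in [t]; integrating over [t <= v] multiplies it by the length of the piece
    below [v]. *)
Definition checkerboard u1 u2 v :=
  \sum_(0 <= k < n.+1) \sum_(0 <= i < n.+1) \sum_(0 <= j < n.+1)
    cell_cdf n i u1 * cell_cdf n j u2 * ramp (brk k i j) (brk k i j.+1) v.

Lemma strip_x0 k x : (k < n.+1)%N -> II x -> strip k x 0 = 0.
Proof.
move=> kn hx; have [C0 _] := cC; rewrite /strip.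
have [_ -> _] := C0 x (g k) hx (grid_II (ltnW kn)).
by have [_ -> _] := C0 x (g k.+1) hx (grid_II kn); rewrite subrr.
Qed.

Lemma strip_0y k y : (k < n.+1)%N -> II y -> strip k 0 y = 0.
Proof.
move=> kn hy; have [C0 _] := cC; rewrite /strip.
have [-> _ _] := C0 y (g k) hy (grid_II (ltnW kn)).
by have [-> _ _] := C0 y (g k.+1) hy (grid_II kn); rewrite subrr.
Qed.

Lemma strip_11 k : (k < n.+1)%N -> strip k 1 1 = g k.+1 - g k.
Proof.
move=> kn; have [_ [C1 _]] := cC; rewrite /strip.
have [_ _ ->] := C1 (g k) (grid_II (ltnW kn)).
by have [_ _ ->] := C1 (g k.+1) (grid_II kn).
Qed.

Lemma strip_homo k x x' y : (k < n.+1)%N -> II x -> II x' -> II y -> x <= x' ->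
  strip k x y <= strip k x' y.
Proof.
move=> kn hx hx' hy xx'; have [C0 [_ Ci]] := cC.
have [hk hk'] := (grid_II (ltnW kn), grid_II kn).
have := Ci x x' 0 y (g k) (g k.+1) hx hx' II0 hy hk hk' xx'.
move=> /(_ (proj1 (andP (proj1 (II_itv y) hy))) (grid_le _ (leqnSn _))).
have [_ A _] := C0 x (g k) hx hk; have [_ A' _] := C0 x' (g k) hx' hk.
have [_ B _] := C0 x (g k.+1) hx hk'; have [_ B' _] := C0 x' (g k.+1) hx' hk'.
by rewrite /strip; lra.
Qed.

(** The gap is the C-volume of the cell. *)
Lemma brk_homo k i j : (k < n.+1)%N -> (i < n.+1)%N -> (j < n.+1)%N ->
  brk k i j <= brk k i j.+1.
Proof.
move=> kn iN jn; have [_ [_ Ci]] := cC.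
have := Ci (g i) (g i.+1) (g j) (g j.+1) (g k) (g k.+1).
move=> /(_ (grid_II (ltnW iN)) (grid_II iN) (grid_II (ltnW jn)) (grid_II jn)).
move=> /(_ (grid_II (ltnW kn)) (grid_II kn)).
rewrite !grid_le// => /(_ isT isT isT).
by rewrite /brk /slab /strip; lra.
Qed.

Lemma brk_i0 k i : (k < n.+1)%N -> (i < n.+1)%N ->
  brk k i 0 = g k + strip k (g i) 1.
Proof.
by move=> kn iN; rewrite /brk /slab grid0 !strip_x0 ?subrr ?addr0//;
  apply: grid_II => //; exact: ltnW.
Qed.

(** Together with [brk_i0], this glues the end of row [i] to the start of row [i.+1]. *)
Lemma brk_iN k i : brk k i n.+1 = g k + strip k (g i.+1) 1.
Proof. by rewrite /brk /slab gridn; ring. Qed.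

Lemma brk_itv k i j : (k < n.+1)%N -> (i < n.+1)%N -> (j <= n.+1)%N ->
  g k <= brk k i j <= g k.+1.
Proof.
move=> kn iN jn.
have hi := grid_II (ltnW iN); have hi' := grid_II iN.
have A := strip_homo kn II0 hi II1 (proj1 (andP (proj1 (II_itv _) hi))).
have B := strip_homo kn hi' II1 II1 (proj2 (andP (proj1 (II_itv _) hi'))).
rewrite strip_0y// in A; rewrite strip_11// in B.
apply/andP; split.
  rewrite /brk -addrA lerDl addr_ge0// subr_ge0.
  by apply: strip_homo => //; rewrite ?grid_le//; apply: grid_II.
suff : brk k i j <= brk k i n.+1 by rewrite brk_iN; lra.
(* Downward induction on [j], from the end of the row. *)
move e : (n.+1 - j)%N => m; elim: m j jn e => [|m ih] j jn e.
  by rewrite (_ : j = n.+1)//; apply/eqP; rewrite eqn_leq jn -subn_eq0 e.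
have jn' : (j < n.+1)%N by rewrite -subn_gt0 e.
apply: (le_trans (brk_homo kn iN jn')); apply: ih => //.
by rewrite subnS e.
Qed.

Lemma brk_II k i j : (k < n.+1)%N -> (i < n.+1)%N -> (j <= n.+1)%N ->
  II (brk k i j).
Proof.
move=> kn iN jn; have /andP[A B] := brk_itv kn iN jn; apply/II_itv.
have /II_itv/andP[A' _] := grid_II (ltnW kn).
by have /II_itv/andP[_ B'] := grid_II kn; rewrite (le_trans A' A) (le_trans B B').
Qed.

(** The pieces run consecutively from 0 to 1, so the increments of any [h] telescope along [j], then
    [i], then [k]. One choice of [h] gives the third margin, another shows that the pieces partition
    [[0,1[]. *)
Lemma sum_brk (h : R -> R) :
  \sum_(0 <= k < n.+1) \sum_(0 <= i < n.+1) \sum_(0 <= j < n.+1)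
    (h (brk k i j.+1) - h (brk k i j)) = h 1 - h 0.
Proof.
transitivity (\sum_(0 <= k < n.+1) (h (g k.+1) - h (g k))); last first.
  by rewrite (telescope_sumr (fun k => h (g k)))// gridn grid0.
apply: eq_big_nat => k /andP[_ kn].
under eq_big_nat => i /andP[_ iN].
  rewrite (telescope_sumr (fun j => h (brk k i j)))// brk_iN brk_i0//.
  over.
rewrite (telescope_sumr (fun i => h (g k + strip k (g i) 1)))// gridn grid0.
by rewrite strip_0y// strip_11// addr0 [g k + _]addrC subrK.
Qed.

Lemma ramp_brk1 k i j : (k < n.+1)%N -> (i < n.+1)%N -> (j < n.+1)%N ->
  ramp (brk k i j) (brk k i j.+1) 1 = slab k i j.+1 - slab k i j.
Proof.
move=> kn iN jn; rewrite ramp_high ?brk_homo//; last first.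
  by have /II_itv/andP[] := brk_II kn iN jn.
by rewrite /brk; ring.
Qed.

(** At a grid point each [cell_cdf] is 0 or 1, and each ramp is full or zero because a piece stays
    inside its slab. What remains is the C-mass of the cells below the point, which telescopes to
    [C]. *)
Lemma checkerboard_grid I J K :
  (I <= n.+1)%N -> (J <= n.+1)%N -> (K <= n.+1)%N ->
  checkerboard (g I) (g J) (g K) = C (g I) (g J) (g K).
Proof.
move=> hI hJ hK; rewrite /checkerboard.
have [C0 _] := cC.
transitivity (\sum_(0 <= k < n.+1) (k < K)%:R *
    (C (g I) (g J) (g k.+1) - C (g I) (g J) (g k))); last first.
  rewrite (sum_telescope_lt (fun k => C (g I) (g J) (g k)))// grid0.
  by have [_ _ ->] := C0 _ _ (grid_II hI) (grid_II hJ); rewrite subr0.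
apply: eq_big_nat => k /andP[_ kn].
transitivity ((k < K)%:R * \sum_(0 <= i < n.+1) (i < I)%:R *
    (strip k (g i.+1) (g J) - strip k (g i) (g J))); last first.
  rewrite (sum_telescope_lt (fun i => strip k (g i) (g J)))// grid0.
  by rewrite strip_0y ?subr0//; exact: grid_II.
rewrite mulr_sumr; apply: eq_big_nat => i /andP[_ iN].
transitivity ((k < K)%:R * ((i < I)%:R * \sum_(0 <= j < n.+1) (j < J)%:R *
    (slab k i j.+1 - slab k i j))); last first.
  rewrite (sum_telescope_lt (slab k i))// /slab grid0.
  by rewrite !strip_x0 ?subrr ?subr0//; apply: grid_II => //; exact: ltnW.
rewrite !mulr_sumr; apply: eq_big_nat => j /andP[_ jn].
rewrite !cell_cdf_grid.
suff -> : ramp (brk k i j) (brk k i j.+1) (g K) =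
  (k < K)%:R * (slab k i j.+1 - slab k i j).
  generalize ((k < K)%:R : R) ((i < I)%:R : R) ((j < J)%:R : R).
  by move=> a b c; ring.
have /andP[A _] := brk_itv kn iN (ltnW jn); have /andP[_ B] := brk_itv kn iN jn.
case: ltnP => kK.
  rewrite ramp_high ?brk_homo ?(le_trans B) ?grid_le//.
  by rewrite /brk mul1r; ring.
by rewrite ramp_low ?mul0r ?brk_homo// (le_trans _ A)// grid_le.
Qed.

Lemma checkerboard_copula3 : copula3 checkerboard.
Proof.
have [_ [C1 _]] := cC.
split; [|split].
- move=> x y hx hy; split; rewrite /checkerboard.
  + by do 3 (apply: big1_seq => ? _); rewrite cell_cdf0 !mul0r.
  + by do 3 (apply: big1_seq => ? _); rewrite cell_cdf0 mulr0 mul0r.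
  + rewrite big_nat; apply: big1 => k /andP[_ kn].
    rewrite big_nat; apply: big1 => i /andP[_ iN].
    rewrite big_nat; apply: big1 => j /andP[_ jn].
    rewrite ramp_low ?mulr0 ?brk_homo//.
    by have /II_itv/andP[] := brk_II kn iN (ltnW jn).
- move=> u hu; split; rewrite /checkerboard.
  (* Summing over [j] and then [k] leaves the mass of the [i]-th interval under the first margin of
     [C], namely [n.+1%:R^-1]. *)
  + transitivity (\sum_(0 <= i < n.+1) \sum_(0 <= k < n.+1)
        cell_cdf n i u * (strip k (g i.+1) 1 - strip k (g i) 1)).
      rewrite exchange_big_nat/=; apply: eq_big_nat => i /andP[_ iN].
      apply: eq_big_nat => k /andP[_ kn].
      under eq_big_nat => j /andP[_ jn] do rewrite cell_cdf1// mulr1 ramp_brk1//.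
      rewrite -mulr_sumr (telescope_sumr (slab k i))// /slab gridn grid0.
      rewrite !strip_x0 ?subrr ?subr0//; apply: grid_II => //; exact: ltnW.
    rewrite -[RHS](@sum_cell_cdf n)//; apply: eq_big_nat => i /andP[_ iN].
    rewrite -mulr_sumr; congr (_ * _); rewrite sumrB /strip.
    rewrite !(telescope_sumr (fun k => C _ 1 (g k)))// gridn grid0 -(gridS n i).
    have [-> _ _] := C1 _ (grid_II iN); have [-> _ _] := C1 _ (grid_II (ltnW iN)).
    have [C0 _] := cC.
    have [_ _ ->] := C0 _ 1 (grid_II iN) II1.
    by have [_ _ ->] := C0 _ 1 (grid_II (ltnW iN)) II1; rewrite !subr0.
  (* The same for the second margin, with the sum over [i] taken first. *)
  + transitivity (\sum_(0 <= k < n.+1) \sum_(0 <= j < n.+1)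
        cell_cdf n j u * (strip k 1 (g j.+1) - strip k 1 (g j))).
      apply: eq_big_nat => k /andP[_ kn].
      rewrite exchange_big_nat/=; apply: eq_big_nat => j /andP[_ jn].
      under eq_big_nat => i /andP[_ iN] do rewrite cell_cdf1// mul1r ramp_brk1//.
      rewrite -mulr_sumr sumrB /slab; congr (_ * _).
      rewrite !(telescope_sumr (fun i => strip k (g i) _))// gridn grid0.
      by rewrite !strip_0y ?subr0//; apply: grid_II => //; exact: ltnW.
    rewrite exchange_big_nat/= -[RHS](@sum_cell_cdf n)//.
    apply: eq_big_nat => i /andP[_ iN].
    rewrite -mulr_sumr; congr (_ * _); rewrite sumrB /strip.
    rewrite !(telescope_sumr (fun k => C 1 _ (g k)))// gridn grid0 -(gridS n i).
    have [_ -> _] := C1 _ (grid_II iN); have [_ -> _] := C1 _ (grid_II (ltnW iN)).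
    have [C0 _] := cC.
    have [_ _ ->] := C0 1 _ II1 (grid_II iN).
    by have [_ _ ->] := C0 1 _ II1 (grid_II (ltnW iN)); rewrite !subr0.
  (* Both distribution functions equal 1 here, and the ramps telescope along the breakpoints. *)
  + transitivity (ramp 0 1 u); last first.
      have /II_itv/andP[u0 u1] := hu.
      by rewrite /ramp min_l// min_r// subr0.
    rewrite /ramp -(sum_brk (Num.min u)); do 3 (apply: eq_big_nat => ? /andP[_ ?]).
    by rewrite !cell_cdf1// !mul1r.
rewrite /checkerboard.
do 3 (apply: incr3_sum => ? ?).
apply: incr3_prod; [exact: cell_cdf_homo..|].
by apply: ramp_homo; exact: brk_homo.
Qed.

(** Both copulas agree at the grid point just below, and from there each grows by an amount between
    0 and [3 * n.+1%:R^-1]. *)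
Lemma checkerboard_near u1 u2 v : II u1 -> II u2 -> II v ->
  `|C u1 u2 v - checkerboard u1 u2 v| <= 3 * n.+1%:R^-1.
Proof.
move=> h1 h2 h3.
have [I hI /andP[I1 I2]] := grid_near n h1.
have [J hJ /andP[J1 J2]] := grid_near n h2.
have [K hK /andP[K1 K2]] := grid_near n h3.
have gI := grid_II hI; have gJ := grid_II hJ; have gK := grid_II hK.
have A := copula3_lip cC gI h1 gJ h2 gK h3 I1 J1 K1.
have B := copula3_lip checkerboard_copula3 gI h1 gJ h2 gK h3 I1 J1 K1.
rewrite checkerboard_grid// in B.
rewrite ler_norml; move: A B I2 J2 K2; set d := n.+1%:R^-1; move: d => d.
move=> /andP[A1 A2] /andP[B1 B2] I2 J2 K2; apply/andP; split; lra.
Qed.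

End Checkerboard.


Local Open Scope classical_set_scope.

(** * Measurability of choices among finitely many sets *)

Section FiniteChoice.
Context d (X : measurableType d) (T : finType) (R : realType).

(** Only finitely many membership patterns exist, so a preimage is a finite union of finite
    intersections of the [J x] and their complements. *)
Lemma measurable_finite_factor (J : T -> set X) (h : {ffun T -> bool} -> \bar R) :
  (forall x, measurable (J x)) ->
  measurable_fun setT (fun t => h [ffun x => `[< J x t >]]).
Proof.
move=> mJ _ B mB; rewrite setTI.
rewrite (_ : _ @^-1` B =
    \bigcup_(f in [set f | B (h f)]) \bigcap_(x in [set: T])
      (if f x then J x else ~` J x)); last first.
  apply/seteqP; split => [t Bt|t [f Bf ft]].
    exists [ffun x => `[< J x t >]] => // x _; rewrite ffunE.
    by case: asboolP.
  rewrite /= (_ : [ffun x => `[< J x t >]] = f)//.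
  apply/ffunP => x; rewrite ffunE; have := ft x I.
  by case: (f x) => ?; [exact/asboolP|exact/asboolPn].
apply: fin_bigcup_measurable; first exact: finite_finset.
move=> f _; apply: fin_bigcap_measurable; first exact: finite_finset.
by move=> x _; case: ifP => // _; exact: measurableC.
Qed.

End FiniteChoice.

(** * Uniform laws on the cells *)

Section UniformCell.
Context {R : realType} (n : nat).

Lemma uniform_prob_cell i (u : R) :
  uniform_prob (@grid_lt R n i) `[0, u] = (cell_cdf n i u)%:E.
Proof.
rewrite /uniform_prob integral_uniform_pdf.
have g0 : 0 <= grid n i :> R by rewrite -(grid0 n) grid_le.
have -> : `[0, u] `&` `[grid n i, grid n i.+1] =
          `[grid n i, Num.min u (grid n i.+1)] :> set R.
  apply/seteqP; split => x /=; rewrite !in_itv/= le_min.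
    by move=> [/andP[_ ->] /andP[-> ->]].
  by move=> /and3P[a -> ->]; rewrite a (le_trans g0 a).
rewrite (eq_integral (fun=> n.+1%:R%:E)); last first.
  move=> x; rewrite inE/= in_itv/= le_min /uniform_pdf => /and3P[-> _ ->].
  by rewrite gridS invrK.
rewrite integral_cst//= lebesgue_measure_itv/= lte_fin /cell_cdf.
case: ifPn => h.
  by rewrite -EFinD -EFinM /ramp (min_r (ltW (lt_le_trans h _)))// ge_min lexx.
rewrite mule0 ramp_low ?mulr0// ?grid_le//.
by move: h; rewrite lt_min grid_lt andbT -leNgt.
Qed.

(* [lebesgue_measure] lives on [measurableTypeR R], kernels on [R] itself; the
   two sigma-algebras coincide but carry different displays. *)
Definition to_real : measurableTypeR R -> R := idfun.

Lemma measurable_to_real : measurable_fun setT to_real.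
Proof. exact: measurable_id. Qed.

HB.instance Definition _ :=
  isMeasurableFun.Build _ _ _ _ to_real measurable_to_real.

Definition uniform_cell i : probability R R :=
  distribution (uniform_prob (@grid_lt R n i)) to_real.

Lemma uniform_cellE i u : uniform_cell i `[0, u] = (cell_cdf n i u)%:E.
Proof. exact: uniform_prob_cell. Qed.

(** Triples are [(k, i, j)] as in [brk]: [x.1.2] and [x.2] index the sides along the first and
    second variables. *)
Definition cell_prob (x : 'I_n.+1 * 'I_n.+1 * 'I_n.+1) :
    probability (R * R)%type R :=
  (uniform_cell x.1.2 \x uniform_cell x.2)%E.

Lemma cell_probE x u1 u2 : cell_prob x (`[0, u1] `*` `[0, u2]) =
  (cell_cdf n x.1.2 u1 * cell_cdf n x.2 u2)%:E.
Proof.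
rewrite /cell_prob/= product_measure1E//.
by rewrite -[X in (X * _)%E]/(uniform_cell _ _)
  -[X in (_ * X)%E]/(uniform_cell _ _) !uniform_cellE.
Qed.

End UniformCell.

(** * The conditional distribution of the checkerboard as a kernel *)

Section CellKernel.
Context {R : realType} (C : R -> R -> R -> R) (n : nat).
Local Notation T := ('I_n.+1 * 'I_n.+1 * 'I_n.+1)%type.

(** Half-open, so that consecutive pieces are disjoint and a cell without mass has an empty
    piece. *)
Definition brk_itv_set (x : T) : set R :=
  `[brk C n x.1.1 x.1.2 x.2, brk C n x.1.1 x.1.2 x.2.+1[.

(** The default cell serves the points outside [[0,1[], in particular [t = 1], so that the kernel is
    a probability at every real. *)
Definition cell_of (f : {ffun T -> bool}) : T :=
  odflt (ord0, ord0, ord0) [pick x | f x].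

Definition cell_at (t : R) : T := cell_of [ffun x => `[< brk_itv_set x t >]].

Definition cell_kernel (t : R) : {measure set (R * R)%type -> \bar R} :=
  cell_prob (cell_at t).

Lemma measurable_cell_kernel U : measurable U ->
  measurable_fun setT (cell_kernel ^~ U).
Proof.
move=> mU; apply: (measurable_finite_factor (fun f => cell_prob (cell_of f) U)).
by move=> x; exact: measurable_itv.
Qed.

HB.instance Definition _ :=
  isKernel.Build _ _ _ _ _ cell_kernel measurable_cell_kernel.

Lemma cell_kernelT t : cell_kernel t setT = 1%E.
Proof. exact: probability_setT. Qed.

HB.instance Definition _ :=
  Kernel_isProbability.Build _ _ _ _ _ cell_kernel cell_kernelT.

End CellKernel.


(** * Integration over the pieces; the checkerboard is simplified *)

Section CellIntegral.
Context {R : realType} (C : R -> R -> R -> R) (n : nat).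
Hypothesis cC : copula3 C.
Local Notation T := ('I_n.+1 * 'I_n.+1 * 'I_n.+1)%type.
Local Notation lo x := (brk C n x.1.1 x.1.2 x.2).
Local Notation hi x := (brk C n x.1.1 x.1.2 x.2.+1).

Lemma sum_cells (F : nat -> nat -> nat -> R) :
  \sum_(0 <= k < n.+1) \sum_(0 <= i < n.+1) \sum_(0 <= j < n.+1) F k i j =
  \sum_(x : T) F x.1.1 x.1.2 x.2.
Proof.
rewrite -(pair_bigA _ (fun (p : 'I_n.+1 * 'I_n.+1) (j : 'I_n.+1) => F p.1 p.2 j))/=.
rewrite -(pair_bigA _ (fun k i : 'I_n.+1 => \sum_(j < n.+1) F k i j))/=.
rewrite big_mkord; apply: eq_bigr => k _; rewrite big_mkord.
by apply: eq_bigr => i _; rewrite big_mkord.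
Qed.

Lemma lo_hi (x : T) : lo x <= hi x.
Proof. exact: brk_homo. Qed.

Lemma sum_cell_indic (t : R) : 0 <= t < 1 ->
  \sum_(x : T) \1_(brk_itv_set C x) t = 1 :> R.
Proof.
move=> /andP[t0 t1].
(* The increment of [h] between the ends of a piece is the indicator of that piece at [t], so
   [sum_brk] applies. *)
pose h b : R := - (b <= t)%R%:R.
transitivity (h 1 - h 0); last by rewrite /h opprK t0 leNgt t1/= oppr0 add0r.
rewrite -(sum_brk n cC h).
rewrite (sum_cells (fun k i j => h (brk C n k i j.+1) - h (brk C n k i j))).
apply: eq_bigr => x _.
rewrite indicE /brk_itv_set mem_setE in_itv/= /h opprK addrC.
have := lo_hi x; case: (leP (hi x) t) => ht lh.
  by rewrite (le_trans lh ht) subrr.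
by rewrite subr0 andbT.
Qed.

Lemma cell_at_sum (c : T -> R) (t : R) : 0 <= t < 1 ->
  c (cell_at C n t) = \sum_(x : T) c x * \1_(brk_itv_set C x) t.
Proof.
move=> /sum_cell_indic s1.
(* Nonnegative indicators of total 1: once one equals 1, the others vanish. *)
have sumD1 (x : T) : brk_itv_set C x t ->
    forall y : T, y != x -> \1_(brk_itv_set C y) t = 0 :> R.
  move=> xt y yx; move: s1; rewrite (bigD1 x)//=.
  rewrite [X in X + _](_ : _ = 1); last by rewrite indicE mem_set.
  rewrite -[RHS]addr0 => /addrI/eqP.
  rewrite psumr_eq0; last by move=> z _; rewrite indicE.
  by move=> /allP/(_ y); rewrite mem_index_enum yx => /(_ isT)/implyP/(_ isT)/eqP.
rewrite /cell_at /cell_of; case: pickP => [x /=|no].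
  rewrite ffunE => /asboolP xt; rewrite (bigD1 x)//= indicE mem_set// mulr1.
  by rewrite big1 ?addr0// => y yx; rewrite (sumD1 x)// mulr0.
exfalso; move: s1; rewrite big1 => [/eqP|x _]; first by rewrite eq_sym oner_eq0.
by have := no x; rewrite ffunE indicE => /asboolPn xt; rewrite memNset.
Qed.

Lemma lebesgue_brk (x : T) v :
  lebesgue_measure (brk_itv_set C x `&` `[0, v[) = (ramp (lo x) (hi x) v)%:E.
Proof.
have /II_itv/andP[l0 _] : II (lo x) by apply: brk_II => //; exact: ltnW.
have -> : brk_itv_set C x `&` `[0, v[ = `[lo x, Num.min v (hi x)[ :> set R.
  rewrite /brk_itv_set; apply/seteqP; split => t /=; rewrite !in_itv/= lt_min.
    by move=> [/andP[-> ->] /andP[_ ->]].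
  by move=> /and3P[a -> ->]; rewrite a (le_trans l0 a).
rewrite lebesgue_measure_itv/= lte_fin.
case: ifPn => h.
  by rewrite -EFinD /ramp (min_r (x := v) (y := lo x))// (ltW (lt_le_trans h _))// ge_min lexx.
have [lh|lh] := ltP (lo x) (hi x).
  by rewrite ramp_low ?(ltW lh)//; move: h; rewrite lt_min lh andbT -leNgt.
have -> : hi x = lo x by apply/eqP; rewrite eq_le lh lo_hi.
by rewrite /ramp subrr.
Qed.

Lemma integral_cell (c : T -> R) v : (forall x, 0 <= c x) -> II v ->
  (\int[lebesgue_measure]_(t in `[0%R, v]) (c (cell_at C n t))%:E)%E =
  (\sum_(x : T) c x * ramp (lo x) (hi x) v)%:E.
Proof.
move=> c0 hv; have /II_itv/andP[v0 v1] := hv.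
have mc : measurable_fun setT (fun t : measurableTypeR R => (c (cell_at C n t))%:E).
  apply: (@measurable_finite_factor _ (measurableTypeR R) _ _ (@brk_itv_set _ C n)
    (fun f => (c (cell_of f))%:E)).
  by move=> x; exact: measurable_itv.
(* The endpoint [v] is dropped because it may be 1, where [cell_at] takes its default value. *)
rewrite -integral_itv_bndo_bndc; last exact: measurable_funTS.
transitivity (\int[lebesgue_measure]_(t in `[0%R, v[)
    (\sum_(x : T) (c x)%:E * (\1_(brk_itv_set C x) t)%:E))%E.
  apply: eq_integral => t; rewrite inE/= in_itv/= => /andP[t0 tv].
  rewrite cell_at_sum ?t0 ?(lt_le_trans tv)// -sumEFin.
  by apply: eq_bigr => x _; rewrite EFinM.
have mi (x : T) : measurable_fun (`[0, v[%classic : set (measurableTypeR R))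
    (fun t => (\1_(brk_itv_set C x) t)%:E).
  by apply: measurable_funTS; apply/measurable_EFinP;
    apply: (@measurable_indic _ (measurableTypeR R)); exact: measurable_itv.
rewrite ge0_integral_sum//=.
- rewrite -sumEFin; apply: eq_bigr => x _.
  rewrite ge0_integralZl_EFin// integral_indic//; last exact: measurable_itv.
  by rewrite EFinM; congr (_ * _)%E; exact: lebesgue_brk.
- move=> x; apply: measurable_funeM; exact: mi.
- by move=> x t _; rewrite -EFinM lee_fin mulr_ge0// c0.
Qed.

Lemma checkerboard_cond_dist :
  cond_dist_version (checkerboard C n) (cell_kernel C n).
Proof.
move=> u1 u2 v h1 h2 hv.
pose c (x : T) := cell_cdf n x.1.2 u1 * cell_cdf n x.2 u2.
transitivity (\int[lebesgue_measure]_(t in `[0%R, v]) (c (cell_at C n t))%:E)%E;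
  last by apply: eq_integral => t _; exact/esym/cell_probE.
rewrite integral_cell//.
  congr _%:E; rewrite /checkerboard.
  exact: (sum_cells (fun k i j => cell_cdf n i u1 * cell_cdf n j u2 *
    ramp (brk C n k i j) (brk C n k i j.+1) v)).
have /II_itv/andP[u10 _] := h1; have /II_itv/andP[u20 _] := h2.
by move=> x; rewrite mulr_ge0// cell_cdf_ge0.
Qed.

Lemma F13_cell u t : F13 (cell_kernel C n) u t = cell_cdf n (cell_at C n t).1.2 u.
Proof.
rewrite /F13 /II [X in fine X](cell_probE (cell_at C n t) u 1)/=.
by rewrite (cell_cdf1 (ltn_ord _)) mulr1.
Qed.

Lemma F23_cell u t : F23 (cell_kernel C n) u t = cell_cdf n (cell_at C n t).2 u.
Proof.
rewrite /F23 /II [X in fine X](cell_probE (cell_at C n t) 1 u)/=.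
by rewrite (cell_cdf1 (ltn_ord _)) mul1r.
Qed.

Lemma continuous_cell_cdf i : continuous (cell_cdf n i : R -> R).
Proof.
have cmin b : continuous (fun x : R => Num.min x b).
  by move=> x; apply: (@continuous_min R R idfun (cst b)); [exact: cvg_id|exact: cvg_cst].
by move=> u; apply: cvgM; [exact: cvg_cst|apply: cvgB; exact: cmin].
Qed.

Lemma copula2_prod : copula2 (fun x y : R => x * y).
Proof.
split=> [u _|a1 b1 a2 b2 _ _ _ _ h1 h2]; first by rewrite mul0r mulr0 mul1r mulr1.
have := mulr_ge0 (_ : 0 <= b1 - a1) (_ : 0 <= b2 - a2).
by rewrite !subr_ge0 => /(_ h1 h2); lra.
Qed.

Lemma checkerboard_simplified : simplified (checkerboard C n).
Proof.
exists (cell_kernel C n); split.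
  split; [exact: checkerboard_copula3|split; first exact: checkerboard_cond_dist].
  apply: nearW => t _; split.
    by rewrite (_ : F13 _ ^~ t = cell_cdf n (cell_at C n t).1.2);
      [exact: continuous_cell_cdf|apply/funext => u; rewrite F13_cell].
  by rewrite (_ : F23 _ ^~ t = cell_cdf n (cell_at C n t).2);
    [exact: continuous_cell_cdf|apply/funext => u; rewrite F23_cell].
exists (fun x y => x * y); split; first exact: copula2_prod.
move=> u1 u2 v h1 h2 hv; rewrite (checkerboard_cond_dist h1 h2 hv).
apply: eq_integral => t _; rewrite F13_cell F23_cell; exact: cell_probE.
Qed.

End CellIntegral.


(** * Averages of copulas over the conditioning variable *)

Section PartialCopula.
Context {R : realType}.
Local Notation mu := (@lebesgue_measure R).
Implicit Types (f g : R -> R) (c : R).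

Lemma ae_lebesgueS (P Q : R -> Prop) : (forall t, P t -> Q t) ->
  {ae mu, forall t, P t} -> {ae mu, forall t, Q t}.
Proof. exact: (@filterS _ _ (ae_filter_ringOfSetsType mu)). Qed.

Lemma lebesgue_II : mu II = 1%E.
Proof. by rewrite /II lebesgue_measure_itv/= lte_fin ltr01 oppr0 adde0. Qed.

Lemma measurable_II : measurable (II : set (measurableTypeR R)).
Proof. exact: measurable_itv. Qed.

Lemma measurable_EFin_II f : measurable_fun setT f ->
  measurable_fun (II : set (measurableTypeR R)) (fun t => (f t)%:E).
Proof.
move=> mf; have mf' : measurable_fun (setT : set (measurableTypeR R)) f := mf.
by apply: measurable_funTS; exact/measurable_EFinP.
Qed.

Lemma integrable_II f : measurable_fun setT f ->
  {ae mu, forall t, II t -> 0 <= f t <= 1} -> mu.-integrable II (EFin \o f).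
Proof.
move=> mf f01; apply/integrableP; split; first exact: measurable_EFin_II.
apply: (@le_lt_trans _ _ (\int[mu]_(t in II) (cst 1%:E) t)%E); last first.
  by rewrite integral_cst//= ?lebesgue_II ?mule1 ?ltry//; exact: measurable_II.
apply: ae_ge0_le_integral => //.
- exact: measurable_II.
- by apply: measurableT_comp => //; exact: measurable_EFin_II.
- move: f01; apply: ae_lebesgueS => t h It; have /andP[f0 f1] := h It.
  by rewrite /= lee_fin ger0_norm.
Qed.

Lemma Rintegral_II_cst f c : measurable_fun setT f ->
  {ae mu, forall t, II t -> f t = c} -> \int[mu]_(t in II) f t = c.
Proof.
move=> mf fc; rewrite /Rintegral (ae_eq_integral (cst c%:E))//.
- by rewrite integral_cst//= ?lebesgue_II ?mule1//; exact: measurable_II.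
- exact: measurable_II.
- exact: measurable_EFin_II.
- by move: fc; apply: ae_lebesgueS => t h It; rewrite h.
Qed.

Lemma Rintegral_II_ge0 f : measurable_fun setT f ->
  {ae mu, forall t, II t -> 0 <= f t} -> 0 <= \int[mu]_(t in II) f t.
Proof.
(* Replacing [f] by its positive part turns the a.e. sign condition into a pointwise one. *)
move=> mf f0; rewrite /Rintegral
  (ae_eq_integral (fun t : measurableTypeR R => (Num.max 0 (f t))%:E))//.
- by apply: fine_ge0; apply: integral_ge0 => t _; rewrite lee_fin le_max lexx.
- exact: measurable_II.
- exact: measurable_EFin_II.
- by apply: measurable_EFin_II; exact: measurable_maxr.
- by move: f0; apply: ae_lebesgueS => t h It; rewrite max_r// h.
Qed.

Lemma copula2_itv (A : R -> R -> R) x y : copula2 A -> II x -> II y ->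
  0 <= A x y <= 1.
Proof.
move=> [A0 Ai] hx hy.
move: (proj1 (II_itv _) hx) (proj1 (II_itv _) hy) => /andP[x0 x1] /andP[y0 y1].
have := Ai 0 x 0 y II0 hx II0 hy x0 y0.
have := Ai 0 x y 1 II0 hx hy II1 x0 y1.
have [? ? ? ?] := A0 x hx; have [? ? ? ?] := A0 y hy.
have [? ? ? ?] := A0 0 II0; have [? ? ? ?] := A0 1 II1.
lra.
Qed.

(** Each copula axiom is linear in the values of the copula, hence survives averaging over an
    interval of measure 1. *)
Lemma partial_copula_copula2 (K : R.-pker R ~> (R * R)%type) Ct :
  sklar_family K Ct -> copula2 (partial_copula Ct).
Proof.
move=> [mC aeC].
have ae2 (P : (R -> R -> R) -> Prop) : (forall A, copula2 A -> P A) ->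
    {ae mu, forall t, II t -> P (Ct t)}.
  by move=> h; move: aeC; apply: ae_lebesgueS => t H It; apply: h; have [] := H It.
have PE s1 s2 : partial_copula Ct s1 s2 = \int[mu]_(t in II) Ct t s1 s2 by [].
have iC s1 s2 : II s1 -> II s2 -> mu.-integrable II (EFin \o (fun t => Ct t s1 s2)).
  move=> h1 h2; apply: integrable_II => //.
  by apply: (ae2 (fun A => 0 <= A s1 s2 <= 1)) => A cA; exact: copula2_itv.
split.
  move=> u hu; rewrite !PE; split; apply: Rintegral_II_cst => //.
  - by apply: (ae2 (fun A => A 0 u = 0)) => A [A0 _]; have [] := A0 u hu.
  - by apply: (ae2 (fun A => A u 0 = 0)) => A [A0 _]; have [] := A0 u hu.
  - by apply: (ae2 (fun A => A 1 u = u)) => A [A0 _]; have [] := A0 u hu.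
  - by apply: (ae2 (fun A => A u 1 = u)) => A [A0 _]; have [] := A0 u hu.
move=> a1 b1 a2 b2 ha1 hb1 ha2 hb2 h1 h2; rewrite !PE.
have mII := measurable_II.
have i1 := iC _ _ hb1 hb2; have i2 := iC _ _ ha1 hb2.
have i3 := iC _ _ hb1 ha2; have i4 := iC _ _ ha1 ha2.
have i12 := integrableB mII i1 i2; have i123 := integrableB mII i12 i3.
rewrite -RintegralB// -RintegralB// -RintegralD//.
apply: Rintegral_II_ge0.
  by apply: measurable_funD => //; do 2 (apply: measurable_funB => //).
apply: (ae2 (fun A => 0 <= A b1 b2 - A a1 b2 - A b1 a2 + A a1 a2)) => A [_]; exact.
Qed.

(** Every simple function below [h] is below [k], so the suprema compare. This bounds the integral
    defining [pvc] without first proving its integrand measurable. *)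
Lemma ge0_le_integral_nonmeasurable d (T : measurableType d)
    (m : {measure set T -> \bar R}) (D : set T) (h k : T -> \bar R) :
  (forall x, D x -> 0 <= h x)%E -> (forall x, D x -> h x <= k x)%E ->
  (\int[m]_(x in D) h x <= \int[m]_(x in D) k x)%E.
Proof.
move=> h0 hk; have k0 x : D x -> (0 <= k x)%E.
  by move=> Dx; exact: le_trans (h0 x Dx) (hk x Dx).
rewrite !ge0_integralE//; apply: ge_ereal_sup => _ [s /= sh <-].
apply: ereal_sup_ubound; exists s => //= x.
by apply: le_trans (sh x) _; exact: lee_restrict.
Qed.

Lemma integral_itv_bounds f v : (forall t, 0 <= f t <= 1) -> II v ->
  (0 <= \int[mu]_(t in `[0%R, v]) (f t)%:E <= 1%:E)%E.
Proof.
move=> f01 /II_itv/andP[v0 v1]; apply/andP; split.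
  by apply: integral_ge0 => t _; rewrite lee_fin; have /andP[] := f01 t.
apply: (@le_trans _ _ (\int[mu]_(t in `[0%R, v]) (cst 1%:E) t)%E).
  by apply: ge0_le_integral_nonmeasurable => t _; rewrite lee_fin;
    have /andP[] := f01 t.
rewrite integral_cst//= mul1e lebesgue_measure_itv/= lte_fin.
by case: ifPn => _; rewrite -?EFinD lee_fin ?subr0// ler01.
Qed.

(** * The partial vine copula *)

Section Kernel.
Variable K : R.-pker R ~> (R * R)%type.

Lemma fine_pker_II t U : measurable U -> II (fine (K t U)).
Proof.
move=> mU; have K1 : (K t U <= 1%:E)%E.
  by rewrite -(@prob_kernel _ _ _ _ _ K t) le_measure// inE.
by apply/II_itv; rewrite fine_ge0//= -lee_fin fineK// ge0_fin_numE// (le_lt_trans K1)// ltry.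
Qed.

Lemma F13_II u t : II (F13 K u t).
Proof. by apply: fine_pker_II; apply: measurableX; exact: measurable_itv. Qed.

Lemma F23_II u t : II (F23 K u t).
Proof. by apply: fine_pker_II; apply: measurableX; exact: measurable_itv. Qed.

Variable Ct : R -> R -> R -> R.
Hypothesis hS : sklar_family K Ct.

(** The integral lies in [[0,1]], hence is finite, and [fine] loses nothing. *)
Lemma pvc_integral u1 u2 v : II v ->
  (pvc K Ct u1 u2 v)%:E = (\int[mu]_(t in `[0%R, v])
    (partial_copula Ct (F13 K u1 t) (F23 K u2 t))%:E)%E /\
  0 <= pvc K Ct u1 u2 v <= 1.
Proof.
move=> hv; have /andP[I0 I1] := integral_itv_bounds
  (fun t => copula2_itv (partial_copula_copula2 hS) (F13_II u1 t) (F23_II u2 t)) hv.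
have IE : (pvc K Ct u1 u2 v)%:E = (\int[mu]_(t in `[0%R, v])
    (partial_copula Ct (F13 K u1 t) (F23 K u2 t))%:E)%E.
  by rewrite /pvc fineK// ge0_fin_numE// (le_lt_trans I1)// ltry.
by split => //; rewrite -!lee_fin IE I0 I1.
Qed.

(** If the two agreed on the whole cube, [K] and the partial copula would witness that [C] is
    simplified. *)
Lemma pvc_neq C : in_C3c C K -> ~ simplified C ->
  exists u1 u2 v, [/\ II u1, II u2, II v & C u1 u2 v != pvc K Ct u1 u2 v].
Proof.
move=> CK nS; apply: contrapT => nE; apply: nS; exists K; split => //.
exists (partial_copula Ct); split; first exact: partial_copula_copula2 hS.
move=> u1 u2 v h1 h2 hv; have [<- _] := pvc_integral u1 u2 hv; congr _%:E.
by apply/eqP/negPn/negP => ne; apply: nE; exists u1, u2, v.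
Qed.

End Kernel.

(** * Sup-distance and density of the simplified copulas *)

Lemma dinf_gt0 (C E : R -> R -> R -> R) u1 u2 v :
  (forall x y z, II x -> II y -> II z -> 0 <= C x y z <= 1) ->
  (forall x y z, II x -> II y -> II z -> 0 <= E x y z <= 1) ->
  II u1 -> II u2 -> II v -> C u1 u2 v != E u1 u2 v -> 0 < dinf C E.
Proof.
move=> C01 E01 h1 h2 hv ne; apply: (@lt_le_trans _ _ `|C u1 u2 v - E u1 u2 v|).
  by rewrite normr_gt0 subr_eq0.
(* [sup] dominates the members of the set only once the set is bounded; values in [[0,1]] give the
   bound 1. *)
apply: ub_le_sup; last by exists u1, u2, v.
exists 1 => _ [x [y [z [hx hy hz ->]]]].
have /andP[a b] := C01 _ _ _ hx hy hz; have /andP[a' b'] := E01 _ _ _ hx hy hz.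
by rewrite ler_norml; apply/andP; split; lra.
Qed.

Lemma dinf_le (C E : R -> R -> R -> R) e :
  (forall x y z, II x -> II y -> II z -> `|C x y z - E x y z| <= e) ->
  dinf C E <= e.
Proof.
move=> h; apply: ge_sup; last by move=> _ [x [y [z [hx hy hz ->]]]]; exact: h.
by exists `|C 0 0 0 - E 0 0 0|, 0, 0, 0; split.
Qed.

Lemma simplified_dense (C : R -> R -> R -> R) e : copula3 C -> 0 < e ->
  exists D, simplified D /\ dinf C D < e.
Proof.
(* Then [3 / e < n.+1], which makes [3 * n.+1%:R^-1] smaller than [e]. *)
move=> cC e0; set n := Num.truncn (3 / e).
exists (checkerboard C n); split; first exact: checkerboard_simplified.
apply: (@le_lt_trans _ _ (3 * n.+1%:R^-1)).
  by apply: dinf_le => x y z; exact: checkerboard_near.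
rewrite ltr_pdivrMr ?ltr0n// mulrC -ltr_pdivrMr//.
by have /andP[] := Num.Theory.truncn_itv (ltW (divr_gt0 (ltr0n R 3 : 0 < 3%:R) e0)).
Qed.

End PartialCopula.

Unset Implicit Arguments.

Theorem theorem5p1 (R : realType) (C : R -> R -> R -> R)
  (K : R.-pker R ~> (R * R)%type) (Ct : R -> R -> R -> R) :
  in_C3c C K -> ~ simplified C -> sklar_family K Ct ->
  exists D : R -> R -> R -> R,
    simplified D /\ dinf C D < dinf C (pvc K Ct).
Proof.
move=> CK nS hS; have [cC _] := CK.
have [u1 [u2 [v [h1 h2 hv ne]]]] := pvc_neq hS CK nS.
(* The tolerance is the distance from [C] to its partial vine copula. *)
apply: (simplified_dense cC); apply: (dinf_gt0 _ _ h1 h2 hv ne) => x y z hx hy hz.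
  exact: copula3_itv cC hx hy hz.
exact: (pvc_integral hS x y hz).2.
Qed.
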